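(* Let $T_i\in M_n(\mathbb{C})$ $(i=1,\dots,n)$ be positive semi-definite. If $0\le\vartheta_i\le1$ $(i=1,\dots,n)$ with $\sum_{i=1}^n\vartheta_i=1$, then $$\sum_{k=1}^{n}\operatorname{tr}(\vartheta_kT_k)\ge\operatorname{tr}\left|\prod_{k=1}^{n}T_k^{\vartheta_k}\right|+r\left(\sum_{k=1}^{n}\operatorname{tr}(T_k)-n\sqrt[n]{\prod_{k=1}^{n}\operatorname{tr}(T_k)}\right),$$ where $r=\min\{\vartheta_k:k=1,\dots,n\}$.
   Context: $M_n(\mathbb{C})$ is the algebra of $n\times n$ complex matrices, and $|A|=\sqrt{A^*A}$. The product $\prod_{k=1}^nT_k^{\vartheta_k}$ is taken in the order $T_1^{\vartheta_1}\cdots T_n^{\vartheta_n}$; powers are taken by the functional calculus (with exponent $0$ giving the identity). *)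

(* Defs.v *)
From mathcomp Require Import all_boot all_order all_algebra.
From mathcomp Require Import spectral sesquilinear complex.
From mathcomp Require Import all_classical all_reals exp.

Set Implicit Arguments.
Unset Strict Implicit.
Unset Printing Implicit Defensive.

Import Order.TTheory GRing.Theory Num.Theory.
Local Open Scope ring_scope.
Local Open Scope complex_scope.
Local Open Scope sesquilinear_scope.

(* The order of R[i] is partial: [0 <= z] means that z is real and nonnegative. *)
Definition psdmx (R : realType) (m : nat) (A : 'M[R[i]]_m) : Prop :=
  A \is hermsymmx /\ forall x : 'cV[R[i]]_m, 0 <= (x^t* *m A *m x) 0 0.

(* If A is normal, then A = U^-1 *m diag_mx (spectral_diag A) *m U with
   U = spectralmx A unitary, and f is applied to the eigenvalues of A. The value
   does not depend on the diagonalization; it is meaningful only for normal A. *)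
Definition mxfun (R : realType) (m : nat) (f : R[i] -> R[i]) (A : 'M[R[i]]_m) :
    'M[R[i]]_m :=
  invmx (spectralmx A) *m diag_mx (map_mx f (spectral_diag A)) *m spectralmx A.

(* For positive semidefinite A, whose eigenvalues are nonnegative reals.
   Since powR 0 0 = 1, the exponent 0 gives the identity even if A is singular. *)
Definition powmx (R : realType) (m : nat) (A : 'M[R[i]]_m) (t : R) : 'M[R[i]]_m :=
  mxfun (fun z => (powR (complex.Re z) t)%:C) A.

Definition absmx (R : realType) (m : nat) (A : 'M[R[i]]_m) : 'M[R[i]]_m :=
  mxfun sqrtC (A^t* *m A).

(* Main.v *)
Require Import Defs.
From mathcomp Require Import all_boot all_order all_algebra.
From mathcomp Require Import spectral sesquilinear complex.
From mathcomp Require Import all_classical all_reals exp.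
From mathcomp Require Import topology normedtype sequences ring.

Set Implicit Arguments.
Unset Strict Implicit.
Unset Printing Implicit Defensive.

Import Order.TTheory GRing.Theory Num.Theory.
Import numFieldNormedType.Exports.
Local Open Scope classical_set_scope.
Local Open Scope ring_scope.
Local Open Scope complex_scope.
Local Open Scope sesquilinear_scope.

(** The inequality is the composition of two others.

    The first is a Hölder inequality for the trace norm,
    [tr |prod_k T_k ^ theta_k| <= prod_k (tr T_k) ^ theta_k]
    ([mxtrace_absmx_prod_powmx_le]). The second is a scalar refinement of the
    weighted arithmetic-geometric mean inequality for the numbers [tr T_k]
    ([refined_AGM]): it is the plain weighted inequality with the weights
    [theta_k - r] on the [tr T_k] and the weight [r * n] on their geometric
    mean.

    The Hölder inequality is usually derived from complex interpolation or from
    majorization of singular values. Here only Cauchy-Schwarz is used. For a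
    number of factors [N] that is a power of 2, one has the polynomial
    inequality
    [|tr (A_1 ... A_N)| ^ N <= prod_i tr ((A_i^* A_i) ^ (N/2))]
    ([mxtrace_chessboard]), by induction on [log2 N]: multiply the factors two
    by two, apply the case [N/2] to these products, and then apply it again to
    the traces that arise. If the exponents are [theta_k = a_k / N], the product
    of the [T_k ^ theta_k] has [N] factors, [a_k] of which equal [T_k ^ (1/N)],
    and the [N]-th power of that factor is [T_k].

    A trace [tr |A|] is brought to the form [tr (W A)] by a polar decomposition
    in which [W] is a partial isometry ([polar_partial_isometry]); [W] is
    absorbed in the first factor because a projection does not increase the
    Schatten norms of hermitian matrices ([schatten2X_projM_le]). General
    exponents are limits of dyadic ones. As [powR 0] is discontinuous at 0, the
    approximations keep the vanishing exponents equal to 0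
    ([dyadic_approx]). In the limit [W] stays fixed, so that the continuity
    of [t |-> T ^ t] suffices, without that of the absolute value. *)

(** * The trace of a product of dyadically many matrices *)

Section TraceHolder.
Context {C : numClosedFieldType} {m : nat}.
Implicit Types (A B P S W X : 'M[C]_m) (s : seq 'M[C]_m).

Lemma adjM A B : (A * B)^t* = B^t* * A^t*.
Proof. by rewrite -mulmxE trmx_mul map_mxM. Qed.

Lemma adjX A k : (A ^+ k)^t* = A^t* ^+ k.
Proof.
elim: k => [|k IHk]; last by rewrite exprS exprSr adjM IHk.
by rewrite !expr0 trmx1 map_mx1.
Qed.

Lemma gram_adj A : (A^t* * A)^t* = A^t* * A.
Proof. by rewrite adjM trmxCK. Qed.

Lemma mxtraceMC A B : \tr (A * B) = \tr (B * A).
Proof. exact: mxtrace_mulC. Qed.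

Lemma mulXC A B k : (A * B) ^+ k * A = A * (B * A) ^+ k.
Proof.
elim: k => [|k IHk]; first by rewrite !expr0 mul1r mulr1.
by rewrite exprSr mulrA -!mulrA [B * A]lock mulrA IHk -lock exprSr !mulrA.
Qed.

Lemma mxtraceXC A B k : \tr ((A * B) ^+ k) = \tr ((B * A) ^+ k).
Proof.
case: k => [|k]; first by rewrite !expr0.
by rewrite exprSr mulrA mulXC mxtraceMC mulrA exprS.
Qed.

Lemma mxtrace_gram A : \tr (A^t* * A) = \sum_i \sum_j `|A i j| ^+ 2.
Proof.
rewrite exchange_big; apply: eq_bigr => j _; rewrite mxE.
by apply: eq_bigr => i _; rewrite !mxE normCK mulrC.
Qed.

Lemma mxtrace_gram_ge0 A : 0 <= \tr (A^t* * A).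
Proof.
by rewrite mxtrace_gram; do 2![apply: sumr_ge0 => ? _]; rewrite exprn_ge0.
Qed.

(** A power [k] of the hermitian matrix [H = A^* A] is again of the form
    [X^* X], with [X = H ^ (k/2)] or [X = A H ^ ((k-1)/2)]. *)
Lemma mxtrace_gramX_ge0 A k : 0 <= \tr ((A^t* * A) ^+ k).
Proof.
set H := A^t* * A; have HH j : (H ^+ j)^t* = H ^+ j by rewrite adjX gram_adj.
rewrite -[k]odd_double_half -addnn exprD; case: odd.
  suff -> : H ^+ true * H ^+ (k./2 + k./2) = (A * H ^+ k./2)^t* * (A * H ^+ k./2).
    exact: mxtrace_gram_ge0.
  by rewrite expr1 exprD mulrA -exprS exprSr adjM HH !mulrA.
by rewrite expr0 mul1r exprD -{1}HH mxtrace_gram_ge0.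
Qed.

Lemma mxtrace_dotmx A B : \tr (A^t* * B) = dotmx (mxvec B) (mxvec A).
Proof.
rewrite dotmxE !mxE (reindex _ (curry_mxvec_bij _ _)) /= /mxtrace.
transitivity (\sum_j \sum_i A^t* j i * B i j).
  by apply: eq_bigr => j _; rewrite -mulmxE mxE.
rewrite exchange_big pair_bigA; apply: eq_bigr => -[i j] _ /=.
by rewrite !mxE !mxvecE mulrC.
Qed.

Lemma mxtrace_CauchySchwarz A B :
  `|\tr (A * B)| ^+ 2 <= \tr (A^t* * A) * \tr (B^t* * B).
Proof.
rewrite -{1}[A]trmxCK [\tr (A^t* * A)]mxtraceMC -{2}[A]trmxCK !mxtrace_dotmx.
by rewrite [leRHS]mulrC; apply: CauchySchwarz.
Qed.

(** For [k > 0], the [2k]-th power of the Schatten norm of [A] of index [2k]: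
    the sum of the [2k]-th powers of its singular values. Working with powers of
    the norms avoids all roots. *)
Definition schatten2X k A : C := \tr ((A^t* * A) ^+ k).

Fixpoint pair_prod s : seq 'M[C]_m :=
  if s is A :: B :: s' then A * B :: pair_prod s' else [::].

Lemma size_pair_prod k s : size s = k.*2 -> size (pair_prod s) = k.
Proof. by elim: k s => [|k IHk] [|A [|B s]] //= [/IHk ->]. Qed.

Lemma prod_pair_prod k s : size s = k.*2 ->
  \prod_(B <- pair_prod s) B = \prod_(A <- s) A.
Proof.
elim: k s => [|k IHk] [|A [|B s]] //= [/IHk E].
by rewrite !big_cons E mulrA.
Qed.

Lemma ler_prod_pair (f g : 'M[C]_m -> C) k s :
    (forall A, 0 <= f A) -> (forall A B, f (A * B) ^+ 2 <= g A * g B) ->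
    size s = k.*2 ->
  (\prod_(B <- pair_prod s) f B) ^+ 2 <= \prod_(A <- s) g A.
Proof.
move=> f_ge0 fg; elim: k s => [|k IHk] [|A [|B s]] //= => [_|[/IHk le_s]].
  by rewrite !big_nil expr1n.
rewrite !big_cons exprMn mulrA ler_pM ?exprn_ge0 ?prodr_ge0 //.
Qed.

Lemma prod_nseq (S : pzSemiRingType) (I : Type) n (x : I) (F : I -> S) :
  \prod_(i <- nseq n x) F i = F x ^+ n.
Proof. by rewrite big_nseq; elim: n => //= n ->; rewrite exprS. Qed.

(** Induction from [N = 2 ^ l.+1] to [2N]. The inequality for [N] bounds the
    trace by the [schatten2X] of the products of neighbours, so it remains to
    see that [schatten2X (N/2) (A B) ^ 2] is at most
    [schatten2X N A * schatten2X N B]. By cyclicity the left trace is that of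
    the alternating word [(P Q) ^ (N/2)] with [P = A^* A] and [Q = B B^*]. This
    word has [N] letters and the inequality for [N] applies to it as well. The
    initial case is Cauchy-Schwarz. *)
Lemma mxtrace_chessboard l s : size s = (2 ^ l.+1)%N ->
  `|\tr (\prod_(A <- s) A)| ^+ (2 ^ l.+1) <= \prod_(A <- s) schatten2X (2 ^ l) A.
Proof.
elim: l s => [|l IHl] s sz_s.
  case: s sz_s => [|A [|B [|? ?]]] //= _; rewrite !big_cons !big_nil !mulr1.
  exact: mxtrace_CauchySchwarz.
have sz_s2 : size s = (2 ^ l.+1).*2 by rewrite sz_s -mul2n -expnS.
rewrite -(prod_pair_prod sz_s2) expnSr exprM.
apply: le_trans (ler_prod_pair (f := schatten2X (2 ^ l)) _ _ sz_s2); last 2 first.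
- by move=> A; apply: mxtrace_gramX_ge0.
- move=> A B; set P := A^t* * A; set Q := B * B^t*.
  have E : schatten2X (2 ^ l) (A * B) = \tr ((P * Q) ^+ (2 ^ l)).
    by rewrite /schatten2X adjM -!mulrA mxtraceXC /P /Q !mulrA.
  have := IHl (flatten (nseq (2 ^ l) [:: P; Q])).
  rewrite !big_flatten /= !prod_nseq !big_cons !big_nil /= !mulr1 -E.
  have -> : schatten2X (2 ^ l) P = schatten2X (2 ^ l.+1) A.
    by rewrite /schatten2X gram_adj -expr2 -exprM expnS.
  have -> : schatten2X (2 ^ l) Q = schatten2X (2 ^ l.+1) B.
    by rewrite /schatten2X /Q -{1}[B]trmxCK gram_adj trmxCK -expr2 -exprM
      mxtraceXC expnS.
  rewrite size_flatten /shape map_nseq sumn_nseq -expnS => /(_ erefl).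
  rewrite ger0_norm ?mxtrace_gramX_ge0 // [X in _ ^+ X <= _]expnS exprM.
  rewrite ler_pXn2r ?expn_gt0 //.
  - by rewrite nnegrE exprn_ge0 // mxtrace_gramX_ge0.
  - by rewrite nnegrE mulr_ge0 // mxtrace_gramX_ge0.
rewrite ler_pXn2r ?nnegrE ?exprn_ge0 ?prodr_ge0 ?IHl ?(size_pair_prod sz_s2) //.
all: by move=> A _; apply: mxtrace_gramX_ge0.
Qed.

Lemma norm_mxtraceX_le l A :
  `|\tr (A ^+ (2 ^ l.+1))| <= schatten2X (2 ^ l) A.
Proof.
have := @mxtrace_chessboard l (nseq (2 ^ l.+1) A) (size_nseq _ _).
by rewrite !prod_nseq ler_pXn2r ?expn_gt0 ?nnegrE ?normr_ge0 // mxtrace_gramX_ge0.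
Qed.

(** The index [2 ^ l.+1] reduces to [2 ^ l] with [S * S] in place of [S]:
    [tr ((S P S) ^ (2 ^ l.+1)) = tr ((P S S) ^ (2 ^ l.+1))], and replacing the
    matrix [P S S] by its modulus can only increase this trace, by
    [norm_mxtraceX_le]. *)
Lemma schatten2X_projM_le l P S : P^t* = P -> P * P = P -> S^t* = S ->
  schatten2X (2 ^ l) (P * S) <= schatten2X (2 ^ l) S.
Proof.
move=> P_adj P_idem; rewrite /schatten2X.
have E X : X^t* = X -> (P * X)^t* * (P * X) = X * P * X.
  by move=> X_adj; rewrite adjM P_adj X_adj -mulrA [P * _]mulrA P_idem mulrA.
elim: l S => [|l IHl] S S_adj.
  rewrite !expr1 -subr_ge0 -raddfB /=.
  (* The difference of the two traces is the trace for the projection 1 - P. *)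
  suff <- : ((1 - P) * S)^t* * ((1 - P) * S) = S^t* * S - (P * S)^t* * (P * S).
    exact: mxtrace_gram_ge0.
  rewrite E // S_adj adjM linearB /= map_mxB P_adj trmx1 map_mx1 S_adj.
  rewrite -mulrA [X in S * X]mulrA -[X in S * (X * S)]/((1 - P) * (1 - P)).
  by rewrite mulrBl mul1r mulrBr mulr1 P_idem subrr subr0 mulrBl mul1r mulrBr mulrA.
have SS_adj : (S * S)^t* = S * S by rewrite adjM S_adj.
rewrite -[leLHS]ger0_norm ?mxtrace_gramX_ge0 // E // -mulrA mxtraceXC -mulrA.
apply: le_trans (norm_mxtraceX_le l _) _; apply: le_trans (IHl _ SS_adj) _.
by rewrite SS_adj S_adj -!expr2 -exprM expnS.
Qed.

(** As [W] is a partial isometry, it can be absorbed in the first letter [S]: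
    [W S] and [P S], with the projection [P = W^* W], have the same modulus. *)
Lemma mxtrace_hermitian_prod_le l W S s :
    (forall A, A \in S :: s -> A^t* = A) ->
    (W^t* * W) * (W^t* * W) = W^t* * W ->
    size (S :: s) = (2 ^ l.+1)%N ->
  `|\tr (W * \prod_(A <- S :: s) A)| ^+ (2 ^ l.+1)
    <= \prod_(A <- S :: s) \tr (A ^+ (2 ^ l.+1)).
Proof.
move=> s_adj W_idem sz_s.
have E A : A \in S :: s -> \tr (A ^+ (2 ^ l.+1)) = schatten2X (2 ^ l) A.
  by move=> /s_adj A_adj; rewrite /schatten2X A_adj -expr2 -exprM expnS.
have /= := @mxtrace_chessboard l ((W * S) :: s).
rewrite !big_cons mulrA => /(_ sz_s) /le_trans; apply.
rewrite E ?mem_head //.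
have -> : \prod_(A <- s) \tr (A ^+ (2 ^ l.+1))
    = \prod_(A <- s) schatten2X (2 ^ l) A.
  rewrite big_seq [RHS]big_seq; apply: eq_bigr => A As;
  by rewrite E // inE As orbT.
apply: ler_wpM2r; first by apply: prodr_ge0 => ? _; apply: mxtrace_gramX_ge0.
have -> : schatten2X (2 ^ l) (W * S) = schatten2X (2 ^ l) (W^t* * W * S).
  congr (\tr (_ ^+ _)); rewrite !adjM trmxCK (s_adj S) ?mem_head //.
  by rewrite -[RHS]mulrA [X in _ = S * X]mulrA W_idem !mulrA.
by apply: schatten2X_projM_le; rewrite ?gram_adj // s_adj ?mem_head.
Qed.

End TraceHolder.

(** * Spectral calculus and polar decomposition *)

Section Polar.
Context {C : numClosedFieldType} {m : nat}.
Implicit Types (A U : 'M[C]_m) (a b d : 'rV[C]_m).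

Definition unidiag U d := U^t* *m diag_mx d *m U.

Lemma unidiagM U a b : U \is unitarymx ->
  unidiag U a * unidiag U b = unidiag U (\row_j (a 0 j * b 0 j)).
Proof.
move=> U_uni; rewrite /unidiag -mulmx_diag -!mulmxE !mulmxA; congr (_ *m _ *m _).
by rewrite -mulmxA (unitarymxP U_uni) mulmx1.
Qed.

Lemma unidiag_adj U d : (forall j, d 0 j \is Num.real) ->
  (unidiag U d)^t* = unidiag U d.
Proof.
move=> d_real; rewrite /unidiag !trmx_mul !map_mxM tr_diag_mx trmxCK map_diag_mx mulmxA.
by congr (_ *m diag_mx _ *m _); apply/rowP => j; rewrite mxE; apply/CrealP.
Qed.

Lemma mxtrace_unidiag U d : U \is unitarymx -> \tr (unidiag U d) = \sum_j d 0 j.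
Proof.
by move=> U_uni; rewrite /unidiag mxtrace_mulC mulmxA (unitarymxP U_uni) mul1mx
  mxtrace_diag.
Qed.

Lemma spectral_unidiag A : A^t* = A -> A = unidiag (spectralmx A) (spectral_diag A).
Proof.
move=> A_adj; rewrite /unidiag -(invmx_unitary (spectral_unitarymx A)).
by apply/orthomx_spectralP/normalmxP; rewrite A_adj.
Qed.

(** The [j]-th eigenvalue is the value of the quadratic form at the [j]-th
    vector of the eigenbasis. *)
Lemma spectral_diag_ge0 A : A^t* = A ->
  (forall x : 'cV[C]_m, 0 <= (x^t* *m A *m x) 0 0) ->
  forall j, 0 <= spectral_diag A 0 j.
Proof.
move=> /spectral_unidiag; set U := spectralmx A; set d := spectral_diag A.
move=> A_eq A_ge0 j; have U_uni : U \is unitarymx by apply: spectral_unitarymx.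
have := A_ge0 (U^t* *m delta_mx j 0).
rewrite A_eq /unidiag trmx_mul map_mxM trmxCK !mulmxA -[_ *m U *m U^t*]mulmxA.
rewrite (unitarymxP U_uni) mulmx1 -[_ *m U *m U^t*]mulmxA (unitarymxP U_uni) mulmx1.
rewrite trmx_delta map_delta_mx -rowE -colE !mxE eqxx mulr1n.
by [].
Qed.

Lemma gram_ge0 A (x : 'cV[C]_m) : 0 <= (x^t* *m (A^t* *m A) *m x) 0 0.
Proof.
rewrite mulmxA -[_ *m A *m x]mulmxA -map_mxM -trmx_mul mxE.
by apply: sumr_ge0 => i _; rewrite !mxE mulrC -normCK exprn_ge0.
Qed.

(** [W] is [K A^*], where [K] is the pseudo-inverse of [|A|]. The
    pseudo-inverse comes for free from the convention [0^-1 = 0], and it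
    satisfies [K K H K K = K K] for [H = |A|^2]. A unitary [W] would require an
    extension of an isometry to the kernel of [A]. *)
Lemma polar_partial_isometry A (H := A^t* *m A) : exists2 W : 'M[C]_m,
  W^t* * W * (W^t* * W) = W^t* * W &
  W * A = unidiag (spectralmx H) (map_mx sqrtC (spectral_diag H)).
Proof.
have H_adj : H^t* = H by apply: gram_adj.
have H_eq := spectral_unidiag H_adj.
have d_ge0 := spectral_diag_ge0 H_adj (@gram_ge0 A).
move: H_eq d_ge0 (spectral_unitarymx H).
set U := spectralmx H; set d := spectral_diag H => H_eq d_ge0 U_uni.
have dE j : d 0 j = sqrtC (d 0 j) * sqrtC (d 0 j) by rewrite -expr2 sqrtCK.
have [K [K_adj KHK KH]] : exists K : 'M[C]_m,
    [/\ K^t* = K, K * K * H * (K * K) = K * K & K * H = unidiag U (map_mx sqrtC d)].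
  exists (unidiag U (\row_j (sqrtC (d 0 j))^-1)); rewrite H_eq; split.
  - by apply: unidiag_adj => j; rewrite mxE rpredV ger0_real // sqrtC_ge0.
  - rewrite !unidiagM //; congr unidiag; apply/rowP => j.
    rewrite !mxE [X in _ * X * _]dE.
    have [->|s_neq0] := eqVneq (sqrtC (d 0 j)) 0.
      by rewrite !(invr0, mul0r, mulr0).
    by rewrite -[X in X * _]mulrA mulKf // mulVf // mul1r.
  - rewrite unidiagM //; congr unidiag; apply/rowP => j; rewrite !mxE {2}dE.
    by have [->|s_neq0] := eqVneq (sqrtC (d 0 j)) 0; rewrite ?mulr0 ?mulKf.
(* K * A^t* is a partial isometry, as W^* W = A (K K) A^* and A^* A = H. *)
exists (K * A^t*); last by rewrite -mulrA.
rewrite adjM trmxCK K_adj; transitivity (A * (K * K * H * (K * K)) * A^t*).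
  by rewrite -[H]/(A^t* * A) !mulrA.
by rewrite KHK !mulrA.
Qed.

End Polar.

Section PowerMx.
Context {R : realType} {m : nat}.
Implicit Types (T : 'M[R[i]]_m) (t : R).

Lemma psdmx_adj T : psdmx T -> T^t* = T.
Proof.
by case=> T_herm _; have := is_hermitianmxP _ _ _ T_herm; rewrite expr0 scale1r => <-.
Qed.

Definition eigval T j : R := complex.Re (spectral_diag T 0 j).

Lemma eigval_ge0 T j : psdmx T -> 0 <= eigval T j.
Proof.
move=> T_psd; have := spectral_diag_ge0 (psdmx_adj T_psd) (proj2 T_psd) j.
by rewrite lecE => /andP[].
Qed.

Lemma powmxE T t :
  powmx T t = unidiag (spectralmx T) (\row_j (powR (eigval T j) t)%:C).
Proof.
rewrite /powmx /mxfun (invmx_unitary (spectral_unitarymx T)) /unidiag.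
rewrite (_ : map_mx _ _ = \row_j (powR (eigval T j) t)%:C) //.
by apply/rowP => j; rewrite [RHS]mxE [LHS]mxE.
Qed.

Lemma powmx_adj T t : (powmx T t)^t* = powmx T t.
Proof. by rewrite powmxE unidiag_adj // => j; rewrite mxE complex_real. Qed.

Lemma powmxX T t k : (powmx T t) ^+ k = powmx T (t * k%:R).
Proof.
elim: k => [|k IHk].
  rewrite expr0 mulr0 powmxE /unidiag.
  rewrite (_ : (\row_j _) = const_mx 1); last first.
    by apply/rowP => j; rewrite !mxE powRr0.
  rewrite diag_const_mx mulmx1 -[X in X *m _]invmx_unitary ?spectral_unitarymx //.
  by rewrite mulVmx ?spectral_unit.
rewrite exprSr IHk.
rewrite !powmxE.
rewrite (unidiagM _ _ (spectral_unitarymx T)).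
congr unidiag.
apply/rowP => j; rewrite !mxE -rmorphM /= !powRrM !powR_mulrn ?powR_ge0 //.
by rewrite exprSr.
Qed.

Lemma powmx1 T : psdmx T -> powmx T 1 = T.
Proof.
move=> T_psd; have T_adj := psdmx_adj T_psd.
rewrite powmxE [RHS](spectral_unidiag T_adj); congr unidiag; apply/rowP => j.
rewrite mxE powRr1 ?eigval_ge0 // /eigval.
exact/RRe_real/ger0_real/(spectral_diag_ge0 T_adj (proj2 T_psd)).
Qed.

Lemma mxtrace_psd T : psdmx T -> \tr T = (\sum_j eigval T j)%:C.
Proof.
move=> T_psd; rewrite -{1}(powmx1 T_psd) powmxE mxtrace_unidiag ?spectral_unitarymx //.
by rewrite rmorph_sum; apply: eq_bigr => j _; rewrite mxE powRr1 ?eigval_ge0.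
Qed.

End PowerMx.

(** * Dyadic exponents *)

Section Dyadic.
Context {R : realType} {m n : nat}.
Implicit Types (T : 'I_n -> 'M[R[i]]_m) (a : 'I_n -> nat).

(** The product is a word with [N] letters, where [T k ^ (1/N)] occurs [a k]
    times. *)
Lemma norm_mxtrace_dyadic_le l T a (W : 'M[R[i]]_m) (N := (2 ^ l.+1)%N) :
    (forall k, psdmx (T k)) -> W^t* * W * (W^t* * W) = W^t* * W ->
    (\sum_k a k)%N = N ->
  `|\tr (W * \prod_k powmx (T k) ((a k)%:R / N%:R))| ^+ N
    <= \prod_k \tr (T k) ^+ a k.
Proof.
move=> T_psd W_idem a_sum; have N_gt0 : (0 < N)%N by rewrite expn_gt0.
pose S k := powmx (T k) N%:R^-1.
have SX k : S k ^+ a k = powmx (T k) ((a k)%:R / N%:R) by rewrite powmxX mulrC.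
have SN k : S k ^+ N = T k.
  by rewrite powmxX mulVf ?pnatr_eq0 ?gtn_eqF // powmx1.
pose s := flatten [seq nseq (a k) (S k) | k <- index_enum 'I_n].
have sz_s : size s = N.
  rewrite size_flatten /shape -map_comp (eq_map (g := a)) => [|k].
    by rewrite sumnE big_map.
  exact: size_nseq.
have s_prod (V : pzSemiRingType) (F : 'M[R[i]]_m -> V) :
    \prod_(A <- s) F A = \prod_k F (S k) ^+ a k.
  rewrite big_flatten big_map.
  by apply: eq_bigr => k _; rewrite prod_nseq.
have := @mxtrace_hermitian_prod_le R[i] m l W.
have s_adj A : A \in s -> A^t* = A.
  by move=> /flattenP[_ /mapP[k _ ->]] /nseqP[-> _]; apply: powmx_adj.
case E : s sz_s => [|S0 s'] sz_s; first by move: sz_s N_gt0 => /= <-.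
rewrite E in s_adj; move=> /(_ S0 s' s_adj W_idem sz_s).
rewrite -E !s_prod (eq_bigr _ (fun k _ => SX k)) => /le_trans; apply.
by rewrite le_eqVlt (eq_bigr (fun k => \tr (T k) ^+ a k)) ?eqxx // => k _; rewrite SN.
Qed.

End Dyadic.

(** * Limits in the exponents *)

Section Limits.
Context {R : realType}.

Lemma cvgr_sum (I : finType) (f : I -> nat -> R) (a : I -> R) (P : pred I) :
  (forall i, f i l @[l --> \oo] --> a i) ->
  (\sum_(i | P i) f i l) @[l --> \oo] --> \sum_(i | P i) a i.
Proof. by move=> fa; apply: cvg_big => //; exact: add_continuous. Qed.

Lemma cvgr_prod (I : finType) (f : I -> nat -> R) (a : I -> R) :
  (forall i, f i l @[l --> \oo] --> a i) ->
  (\prod_i f i l) @[l --> \oo] --> \prod_i a i.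
Proof. by move=> fa; apply: cvg_big => //; exact: mul_continuous. Qed.

(** [powR x] is continuous except that [powR 0] jumps from 1 to 0 to the right
    of 0; hence the condition on [u] when the limit exponent is 0. *)
Lemma cvg_powR_exponent (x t : R) (u : nat -> R) : 0 <= t ->
    u l @[l --> \oo] --> t -> (t = 0 -> forall l, u l = 0) ->
  powR x (u l) @[l --> \oo] --> powR x t.
Proof.
move=> t_ge0 ut u0; have [t_eq0|t_neq0] := eqVneq t 0.
  by rewrite t_eq0; under eq_fun do rewrite u0 //; exact: cvg_cst.
have [->|x_neq0] := eqVneq x 0.
  rewrite powR0 //; apply: cvg_near_cst; near=> l; rewrite powR0 // gt_eqF //.
  by near: l; apply: cvgr_gt ut _ _; rewrite lt_def t_neq0.
rewrite /powR (negPf x_neq0); apply: (cvg_comp _ expR); last exact: continuous_expR.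
by apply: cvgM => //; exact: cvg_cst.
Unshelve. all: by end_near. Qed.

(** All exponents are rounded down, except for one nonzero exponent [theta k0]
    that absorbs the rounding errors, to keep the sum equal to 1. *)
Lemma dyadic_approx n (theta : 'I_n -> R) : (forall k, 0 <= theta k) ->
    \sum_k theta k = 1 ->
  exists a : nat -> 'I_n -> nat, [/\
    forall l, (\sum_k a l k)%N = (2 ^ l.+1)%N,
    forall k, theta k = 0 -> forall l, a l k = 0%N &
    forall k, (a l k)%:R / (2 ^ l.+1)%:R @[l --> \oo] --> theta k].
Proof.
move=> theta_ge0 theta_sum.
have [k0 theta_k0] : exists k0, theta k0 != 0.
  apply/existsP; rewrite -[X in is_true X]negbK negb_exists.
  apply/negP => /forallP theta0.
  move: theta_sum; rewrite big1 => [/esym/eqP|k _]; first by rewrite oner_eq0.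
  by apply/eqP; have := theta0 k; rewrite negbK.
pose N l := (2 ^ l.+1)%N.
have N_gt0 l : 0 < (N l)%:R :> R by rewrite ltr0n expn_gt0.
pose b l k := Num.trunc (theta k * (N l)%:R).
have b_itv l k : (b l k)%:R <= theta k * (N l)%:R < (b l k).+1%:R.
  by apply: truncn_itv; rewrite mulr_ge0.
have b_cvg k : (b l k)%:R / (N l)%:R @[l --> \oo] --> theta k.
  apply: (@squeeze_cvgr _ _ _ _ (fun l => theta k - harmonic l) (fun=> theta k)).
  (* The rounding error is at most 1 / N l, and l.+1 <= N l. *)
  - apply: nearW => l; have /andP[b_le b_gt] := b_itv l k.
    rewrite ler_pdivrMr // b_le andbT ler_pdivlMr // mulrBl lerBlDr.
    apply: le_trans (ltW b_gt) _; rewrite -natr1 lerD2l /harmonic /=.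
    by rewrite mulrC ler_pdivlMr ?ltr0n // mul1r ler_nat ltnW // ltn_expl.
  - rewrite -[X in _ --> X]subr0; apply: cvgB; first exact: cvg_cst.
    exact: cvg_harmonic.
  - exact: cvg_cst.
have b_sum l : (\sum_(k | k != k0) b l k <= N l)%N.
  rewrite -(ler_nat R) natr_sum.
  apply: le_trans (_ : \sum_(k | k != k0) theta k * (N l)%:R <= _).
    by apply: ler_sum => k _; have /andP[] := b_itv l k.
  rewrite -mulr_suml ler_piMl // -theta_sum [leRHS](bigD1 k0) //=.
  by rewrite lerDr.
exists (fun l k => if k == k0 then (N l - \sum_(k | k != k0) b l k)%N else b l k).
split=> [l|k theta_k l|k].
- rewrite (bigD1 k0) //= eqxx [X in (_ + X)%N](eq_bigr (b l)) => [|k /negPf -> //].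
  by rewrite subnK.
- case: eqP => [k_eq|_]; first by rewrite -k_eq theta_k eqxx in theta_k0.
  by rewrite /b theta_k mul0r truncn0.
case: eqP => [->|_]; last exact: b_cvg.
have -> : theta k0 = 1 - \sum_(k | k != k0) theta k.
  by rewrite -theta_sum (bigD1 k0) //= addrK.
rewrite (_ : (fun l => _) = fun l => 1 - \sum_(k | k != k0) (b l k)%:R / (N l)%:R).
  by apply: cvgB; [exact: cvg_cst | apply: cvgr_sum].
apply/funext => l; rewrite natrB // mulrBl divff ?gt_eqF // natr_sum mulr_suml.
by [].
Qed.

(** Convergence of both coordinates, so that only limits of real sequences are
    involved. *)
Definition cvgc (u : nat -> R[i]) (z : R[i]) :=
  (complex.Re (u l) @[l --> \oo] --> complex.Re z) /\
  (complex.Im (u l) @[l --> \oo] --> complex.Im z).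

Lemma cvgc_cst z : cvgc (fun=> z) z.
Proof. by split; exact: cvg_cst. Qed.

Lemma cvgc_real (u : nat -> R) (x : R) :
  u l @[l --> \oo] --> x -> cvgc (fun l => (u l)%:C) x%:C.
Proof. by split=> //=; exact: cvg_cst. Qed.

Lemma cvgcD u v x y : cvgc u x -> cvgc v y -> cvgc (fun l => u l + v l) (x + y).
Proof.
move=> [u1 u2] [v1 v2]; split.
  rewrite raddfD; under eq_fun do rewrite raddfD; exact: cvgD.
rewrite raddfD; under eq_fun do rewrite raddfD; exact: cvgD.
Qed.

Lemma cvgcM u v x y : cvgc u x -> cvgc v y -> cvgc (fun l => u l * v l) (x * y).
Proof.
have ReM (z w : R[i]) : complex.Re (z * w)
    = complex.Re z * complex.Re w - complex.Im z * complex.Im w by case: z w => ? ? [].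
have ImM (z w : R[i]) : complex.Im (z * w)
    = complex.Re z * complex.Im w + complex.Im z * complex.Re w by case: z w => ? ? [].
move=> [u1 u2] [v1 v2]; split.
  by rewrite ReM; under eq_fun do rewrite ReM; apply: cvgB; apply: cvgM.
by rewrite ImM; under eq_fun do rewrite ImM; apply: cvgD; apply: cvgM.
Qed.

Lemma cvgc_sum (I : Type) (s : seq I) (u : I -> nat -> R[i]) x :
  (forall i, cvgc (u i) (x i)) ->
  cvgc (fun l => \sum_(i <- s) u i l) (\sum_(i <- s) x i).
Proof.
move=> ux; elim: s => [|i s IHs].
  by rewrite big_nil; under eq_fun do rewrite big_nil; exact: cvgc_cst.
by rewrite big_cons; under eq_fun do rewrite big_cons; exact: cvgcD.
Qed.

Definition cvgmx p q (A : nat -> 'M[R[i]]_(p, q)) (B : 'M[R[i]]_(p, q)) :=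
  forall i j, cvgc (fun l => A l i j) (B i j).

Lemma cvgmx_cst p q (A : 'M[R[i]]_(p, q)) : cvgmx (fun=> A) A.
Proof. by move=> i j; exact: cvgc_cst. Qed.

Lemma cvgmxM p q r (A : nat -> 'M[R[i]]_(p, q)) (B : nat -> 'M[R[i]]_(q, r)) A' B' :
  cvgmx A A' -> cvgmx B B' -> cvgmx (fun l => A l *m B l) (A' *m B').
Proof.
move=> AA BB i j; rewrite mxE; under eq_fun do rewrite mxE.
by apply: cvgc_sum => k; exact: cvgcM.
Qed.

Lemma cvgmx_prod p (I : Type) (s : seq I) (A : I -> nat -> 'M[R[i]]_p) B :
  (forall i, cvgmx (A i) (B i)) ->
  cvgmx (fun l => \prod_(i <- s) A i l) (\prod_(i <- s) B i).
Proof.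
move=> AB; elim: s => [|i s IHs].
  by rewrite big_nil; under eq_fun do rewrite big_nil; exact: cvgmx_cst.
by rewrite big_cons; under eq_fun do rewrite big_cons; exact: cvgmxM.
Qed.

Lemma cvgc_mxtrace p (A : nat -> 'M[R[i]]_p) B :
  cvgmx A B -> cvgc (fun l => \tr (A l)) (\tr B).
Proof. by move=> AB; apply: cvgc_sum => i; exact: AB. Qed.

Lemma cvgmx_powmx p (T : 'M[R[i]]_p) (t : R) (u : nat -> R) : 0 <= t ->
    u l @[l --> \oo] --> t -> (t = 0 -> forall l, u l = 0) ->
  cvgmx (fun l => powmx T (u l)) (powmx T t).
Proof.
move=> t_ge0 ut u0; rewrite powmxE; under eq_fun do rewrite powmxE.
apply: cvgmxM; last exact: cvgmx_cst.
apply: cvgmxM; first exact: cvgmx_cst.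
move=> i j; rewrite !mxE; under eq_fun do rewrite !mxE.
case: eqP => _; last exact: cvgc_cst.
by apply: cvgc_real; exact: cvg_powR_exponent.
Qed.

End Limits.

(** * Hölder's inequality for the trace norm *)

Section TraceNormHolder.
Context {R : realType}.

Lemma absmx_polar m (A : 'M[R[i]]_m) : exists2 W : 'M[R[i]]_m,
  W^t* * W * (W^t* * W) = W^t* * W & W * A = absmx A.
Proof.
have [W W_idem WA] := polar_partial_isometry A; exists W => //.
by rewrite WA /absmx /mxfun (invmx_unitary (spectral_unitarymx _)).
Qed.

Lemma mxtrace_absmx_real m (A : 'M[R[i]]_m) : \tr (absmx A) \is Num.real.
Proof.
have H_adj : (A^t* *m A)^t* = A^t* *m A by apply: gram_adj.
rewrite /absmx /mxfun (invmx_unitary (spectral_unitarymx _)).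
rewrite -[X in \tr X]/(unidiag _ _) mxtrace_unidiag ?spectral_unitarymx //.
apply: rpred_sum => j _; rewrite mxE sqrtC_real //.
exact: (spectral_diag_ge0 H_adj (@gram_ge0 _ _ A)).
Qed.

(** The polar factor [W] of the limit product is used for all the
    approximating products, whose trace against [W] is bounded by the dyadic
    case. *)
Lemma mxtrace_absmx_prod_powmx_le m n (T : 'I_n -> 'M[R[i]]_m)
    (theta t : 'I_n -> R) :
    (forall k, psdmx (T k)) -> (forall k, \tr (T k) = (t k)%:C) ->
    (forall k, 0 <= theta k) -> \sum_k theta k = 1 ->
  \tr (absmx (\prod_k powmx (T k) (theta k))) <= (\prod_k powR (t k) (theta k))%:C.
Proof.
move=> T_psd tE theta_ge0 theta_sum.
have t_ge0 k : 0 <= t k.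
  rewrite -lecR -tE mxtrace_psd // lecR.
  by apply: sumr_ge0 => j _; apply: eigval_ge0.
have [W W_idem WA] := absmx_polar (\prod_k powmx (T k) (theta k)).
have tr_real := mxtrace_absmx_real (\prod_k powmx (T k) (theta k)).
rewrite -(RRe_real tr_real) lecR -WA.
have [a [a_sum a0 a_cvg]] := dyadic_approx theta_ge0 theta_sum.
pose e l k : R := (a l k)%:R / (2 ^ l.+1)%:R.
have e0 k : theta k = 0 -> forall l, e l k = 0.
  by move=> /a0 ak0 l; rewrite /e ak0 mul0r.
pose z l := \tr (W * \prod_k powmx (T k) (e l k)).
have z_cvg : cvgc z (\tr (W * \prod_k powmx (T k) (theta k))).
  apply: cvgc_mxtrace; apply: cvgmxM; first exact: cvgmx_cst.
  apply: cvgmx_prod => k;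
  apply: cvgmx_powmx; [exact: theta_ge0|exact: a_cvg|exact: e0].
have y_cvg : \prod_k powR (t k) (e l k) @[l --> \oo]
    --> \prod_k powR (t k) (theta k).
  apply: cvgr_prod => k;
  apply: cvg_powR_exponent; [exact: theta_ge0|exact: a_cvg|exact: e0].
apply: ler_cvg_to (proj1 z_cvg) y_cvg _; apply: nearW => l.
have N_gt0 : (0 < 2 ^ l.+1)%N by rewrite expn_gt0.
have y_ge0 : 0 <= \prod_k powR (t k) (e l k).
  by apply: prodr_ge0 => k _; apply: powR_ge0.
have z_le : `|z l| <= (\prod_k powR (t k) (e l k))%:C.
  rewrite -(ler_pXn2r N_gt0) ?nnegrE ?normr_ge0 ?ler0c //.
  apply: le_trans (norm_mxtrace_dyadic_le T_psd W_idem (a_sum l)) _.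
  rewrite -rmorphXn /= -prodrXl rmorph_prod le_eqVlt; apply/orP; left; apply/eqP.
  apply: eq_bigr => k _; rewrite tE -rmorphXn /=; congr (_%:C).
  rewrite -[RHS]powR_mulrn ?powR_ge0 // -powRrM /e.
  by rewrite divfK ?pnatr_eq0 ?gtn_eqF // powR_mulrn.
have := le_trans (normc_ge_Re (z l)) z_le; rewrite lecR; apply: le_trans.
exact: ler_norm.
Qed.

End TraceNormHolder.

(** * The refined arithmetic-geometric mean inequality *)

(** Write the product on the left as [expR L] when it is positive. The tangent
    inequality [expR L * (1 + (ln x - L)) <= x], applied to the [t k] with
    weights [theta k - r] and to the geometric mean with weight [r * n], adds up
    to the claim, because the logarithms cancel. Zero values of [t k] are
    harmless: either the product vanishes, or [theta k = 0] and thus [r = 0],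
    and the terms in question have weight 0. *)
Lemma refined_AGM (R : realType) n (theta t : 'I_n -> R) (r : R) :
    (forall k, 0 <= t k) -> 0 <= r -> (forall k, r <= theta k) ->
    \sum_k theta k = 1 ->
  \prod_k powR (t k) (theta k)
    + r * (\sum_k t k - n%:R * powR (\prod_k t k) n%:R^-1)
  <= \sum_k theta k * t k.
Proof.
move=> t_ge0 r_ge0 r_le theta_sum.
have theta_ge0 k : 0 <= theta k by apply: le_trans r_ge0 _.
have n_gt0 : (0 < n)%N.
  move: theta_sum; case: n {t t_ge0 theta_ge0} theta r_le => // theta _.
  by rewrite big_ord0 => /esym/eqP; rewrite oner_eq0.
set G := powR (\prod_k t k) n%:R^-1.
have G_ge0 : 0 <= G := powR_ge0 _ _.
(* The plain weighted inequality; the weights add up to (1 - n * r) + r * n. *)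
suff : \prod_k powR (t k) (theta k) <= \sum_k (theta k - r) * t k + r * (n%:R * G).
  under [in X in _ <= X -> _]eq_bigr do rewrite mulrBl.
  rewrite sumrB -mulr_sumr => le_prod.
  by rewrite mulrBr addrA lerBlDr -lerBrDr [leRHS]addrAC.
have rhs_ge0 : 0 <= \sum_k (theta k - r) * t k + r * (n%:R * G).
  by rewrite addr_ge0 ?mulr_ge0 // sumr_ge0 // => k _; rewrite mulr_ge0 // subr_ge0.
have [/existsP[k /andP[/eqP tk0 thk0]]|] :=
    boolP [exists k, (t k == 0) && (theta k != 0)].
  by rewrite (bigD1 k) //= tk0 powR0 // mul0r.
rewrite negb_exists => /forallP t_neq0.
pose L := \sum_k theta k * ln (t k).
have prodE : \prod_k powR (t k) (theta k) = expR L.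
  rewrite expR_sum; apply: eq_bigr => k _; rewrite /powR.
  case: eqP => // tk0; have := t_neq0 k; rewrite tk0 eqxx negbK => /eqP ->.
  by rewrite eqxx mul0r expR0.
have tangent x : 0 < x -> expR L * (1 + (ln x - L)) <= x.
  move=> x_gt0; rewrite -[leRHS](lnK x_gt0) -[in leRHS](subrKC L (ln x)) expRD.
  by rewrite ler_pM2l ?expR_gt0 ?expR_ge1Dx.
have term_le k :
    (theta k - r) * (expR L * (1 + (ln (t k) - L))) <= (theta k - r) * t k.
  have [tk0|tk_neq0] := eqVneq (t k) 0; last first.
    by rewrite ler_wpM2l ?subr_ge0 // tangent // lt_def tk_neq0 t_ge0.
  have := t_neq0 k; rewrite tk0 eqxx negbK => /eqP thk0.
  have r0 : r = 0 by apply/le_anti; rewrite r_ge0 -thk0 r_le.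
  by rewrite thk0 r0 subrr !mul0r.
have G_le :
    r * (n%:R * (expR L * (1 + (n%:R^-1 * \sum_k ln (t k) - L))))
    <= r * (n%:R * G).
  have [->|r_neq0] := eqVneq r 0; first by rewrite !mul0r.
  have t_gt0 k : 0 < t k.
    rewrite lt_def t_ge0 andbT; apply/negP => tk0; have := t_neq0 k.
    rewrite tk0 negbK => /eqP thk0; case/eqP: r_neq0.
    by apply/le_anti; rewrite r_ge0 -thk0 r_le.
  have <- : ln G = n%:R^-1 * \sum_k ln (t k).
    rewrite ln_powR; congr (_ * _); apply: expR_inj.
    rewrite lnK ?posrE ?prodr_gt0 // expR_sum.
    by apply: eq_bigr => k _; rewrite lnK ?posrE.
  by rewrite ler_wpM2l // ler_wpM2l //; apply: tangent; rewrite powR_gt0 // prodr_gt0.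
rewrite prodE; apply: le_trans (lerD (ler_sum _ (fun k _ => term_le k)) G_le).
rewrite le_eqVlt; apply/orP; left; apply/eqP.
have n_neq0 : n%:R != 0 :> R by rewrite pnatr_eq0 gtn_eqF.
set S := \sum_k ln (t k).
have -> : \sum_k (theta k - r) * (expR L * (1 + (ln (t k) - L)))
    = expR L * (1 - L) * \sum_k theta k + expR L * L - r * expR L * S
      - \sum_(k < n) r * expR L * (1 - L).
  rewrite !mulr_sumr -big_split -!sumrB; apply: eq_bigr => k _ /=; ring.
by rewrite theta_sum sumr_const card_ord -mulr_natl; field.
Qed.

(** * The trace inequality *)

Theorem theorem5p9 (R : realType) (m n : nat)
    (T : 'I_n -> 'M[R[i]]_m) (theta : 'I_n -> R) (r : R)
    (T_psd : forall k, psdmx (T k))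
    (theta01 : forall k, 0 <= theta k <= 1)
    (theta_sum : \sum_(k < n) theta k = 1)
    (r_attained : exists k, theta k = r)
    (r_min : forall k, r <= theta k) :
  \sum_(k < n) \tr ((theta k)%:C *: T k) >=
    \tr (absmx (\prod_(k < n) powmx (T k) (theta k)))
    + r%:C * (\sum_(k < n) \tr (T k)
              - n%:R * n.-root (\prod_(k < n) \tr (T k))).
Proof.
have theta_ge0 k : 0 <= theta k by have /andP[] := theta01 k.
have [k0 theta_k0] := r_attained.
have n_gt0 : (0 < n)%N by apply: leq_ltn_trans (ltn_ord k0).
have r_ge0 : 0 <= r by rewrite -theta_k0.
pose t k := \sum_j eigval (T k) j.
have tE k : \tr (T k) = (t k)%:C by exact: mxtrace_psd.
have t_ge0 k : 0 <= t k by apply: sumr_ge0 => j _; apply: eigval_ge0.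
have P_ge0 : 0 <= \prod_k t k by apply: prodr_ge0.
have rootE : n.-root (\prod_k \tr (T k)) = (powR (\prod_k t k) n%:R^-1)%:C.
  under eq_bigr do rewrite tE.
  rewrite -rmorph_prod /= -[RHS](@exprCK _ n) ?ler0c ?powR_ge0 //.
  rewrite -rmorphXn /= -powR_mulrn ?powR_ge0 // -powRrM.
  by rewrite mulVf ?pnatr_eq0 ?gtn_eqF // powRr1.
have -> : \sum_k \tr ((theta k)%:C *: T k) = (\sum_k theta k * t k)%:C.
  by rewrite rmorph_sum; apply: eq_bigr => k _; rewrite linearZ /= tE -rmorphM.
rewrite rootE; under [X in _ + _ * (X - _)]eq_bigr do rewrite tE.
rewrite -rmorph_sum -(rmorph_nat (real_complex R)) -rmorphM -rmorphB -rmorphM /=.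
have le_holder := mxtrace_absmx_prod_powmx_le T_psd tE theta_ge0 theta_sum.
apply: le_trans (lerD le_holder (lexx _)) _; rewrite -rmorphD lecR.
exact: refined_AGM.
Qed.
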